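(* Let $Y \subset \mathbb{R}^n$ be a cut-and-project set (with physical space identified with $\mathbb{R}^n$). Then $Y$ is not a dense forest; in fact, there exist $\varepsilon>0$ and an $(n-1)$-dimensional affine subspace $Z$ of $\mathbb{R}^n$ such that $Y$ contains no points in the $\varepsilon$-neighborhood of $Z$.
   Context: Cut-and-project sets: let $n\ge 1$, $k\ge 1$, $N=n+k$, and write $\mathbb{R}^N = V_{phys}\oplus V_{int}$ with $\dim V_{phys}=n$, $\dim V_{int}=k$; let $\pi_{phys}:\mathbb{R}^N\to V_{phys}$ and $\pi_{int}:\mathbb{R}^N\to V_{int}$ be the projections associated with this direct sum. Let $L\subset\mathbb{R}^N$ be a translated lattice (a set $\bm{x}+\Lambda$ with $\Lambda$ a lattice of full rank in $\mathbb{R}^N$) and let $W\subset V_{int}$ be a bounded set (no further assumptions on $W$ or $L$). The set $\Lambda(L,W)=\pi_{phys}(L\cap\pi_{int}^{-1}(W))\subset V_{phys}$ is a cut-and-project set; $V_{phys}$ is identified with $\mathbb{R}^n$ by a linear isomorphism. A set $Y\subset\mathbb{R}^n$ is a dense forest if there is a function $v:(0,\infty)\to(0,\infty)$ such that for every $\varepsilon>0$, every line segment of length $v(\varepsilon)$ contains a point at distance less than $\varepsilon$ from $Y$ (distances measured in some fixed norm; the choice is immaterial).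
   Formalization: The claim that Y is not a dense forest is stated only for n ≥ 2; for n = 1 it fails (Y = ℤ in ℝ, from L = ℤ², W = {0}, is a dense forest with v = 1). The existence of ε and Z is stated for all n ≥ 1. *)

(* Defs.v *)
From HB Require Import structures.
From mathcomp Require Import all_boot all_order all_algebra.
From mathcomp Require Import all_classical all_reals all_analysis.

Set Implicit Arguments.
Unset Strict Implicit.
Unset Printing Implicit Defensive.

Import Order.TTheory GRing.Theory Num.Theory.
Import numFieldNormedType.Exports.

Local Open Scope classical_set_scope.
Local Open Scope ring_scope.

Section Defs.
Variable R : realType.

Definition is_norm (n : nat) (nrm : 'rV[R]_n -> R) : Prop :=
  [/\ forall x y, nrm (x + y) <= nrm x + nrm y,
      forall (a : R) x, nrm (a *: x) = `|a| * nrm x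
    & forall x, nrm x = 0 -> x = 0].

(* The Z-span of the rows of an invertible matrix, i.e. of a basis of R^N. *)
Definition full_rank_lattice (N : nat) (Lam : set 'rV[R]_N) : Prop :=
  exists B : 'M[R]_N, B \in unitmx /\
    Lam = range (fun z : 'rV[int]_N => map_mx intr z *m B).

Definition translated_lattice (N : nat) (L : set 'rV[R]_N) : Prop :=
  exists (x : 'rV[R]_N) (Lam : set 'rV[R]_N),
    full_rank_lattice Lam /\ L = [set x + l | l in Lam].

(* [daddv_pi U V] is the projection onto [U] along [V]; it takes values in the
   ambient space, and [vsproj U] only corestricts it to the type of [U]. *)
Definition cut_and_project (N : nat) (Vphys Vint : {vspace 'rV[R]_N})
    (L W : set 'rV[R]_N) : set (subvs_of Vphys) :=
  [set vsproj Vphys (daddv_pi Vphys Vint x)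
     | x in L `&` [set x | W (daddv_pi Vint Vphys x)]].

Definition is_cut_and_project_set (n : nat) (Y : set 'rV[R]_n) : Prop :=
  exists (k : nat) (Vphys Vint : {vspace 'rV[R]_(n + k)})
      (phi : {linear subvs_of Vphys -> 'rV[R]_n}) (L W : set 'rV[R]_(n + k)),
    (1 <= k)%N /\
    [/\ directv (Vphys + Vint), (Vphys + Vint)%VS = fullv,
        \dim Vphys = n & \dim Vint = k] /\
    bijective phi /\
    translated_lattice L /\
    (W `<=` [set w | w \in Vint] /\ bounded_set W) /\
    Y = phi @` cut_and_project Vint L W.

Definition neighborhood (n : nat) (nrm : 'rV[R]_n -> R) (Z : set 'rV[R]_n)
    (eps : R) : set 'rV[R]_n :=
  [set x | exists2 z, Z z & nrm (x - z) < eps].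

Definition segment (n : nat) (a b : 'rV[R]_n) : set 'rV[R]_n :=
  [set a + t *: (b - a) | t in `[0, 1]].

Definition dense_forest (n : nat) (nrm : 'rV[R]_n -> R) (Y : set 'rV[R]_n) :
    Prop :=
  exists v : R -> R, forall eps : R, 0 < eps ->
    0 < v eps /\
    forall a b : 'rV[R]_n, nrm (b - a) = v eps ->
      exists2 x, segment a b x & neighborhood nrm Y eps x.

Definition affine_subspace (n d : nat) (Z : set 'rV[R]_n) : Prop :=
  exists (p : 'rV[R]_n) (U : {vspace 'rV[R]_n}),
    \dim U = d /\ Z = [set p + u | u in [set u | u \in U]].

End Defs.

(* Main.v *)
(* A vector of the dual lattice is a functional [h] on [R^N] with integer values
   on the lattice. Since [dim Vint < N], Dirichlet's theorem yields a nonzero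
   such [h] whose restriction to [Vint] is small enough to map [W] into
   [[-1/4, 1/4]]; the dual lattice being discrete, [h] does not vanish on
   [Vphys]. For [x] in the translated lattice with internal component in [W],
   the value of [h] at the physical component of [x] is then within [1/4] of a
   fixed coset of the integers, so the hyperplanes of [Vphys] where [h] takes the
   value halfway between two points of this coset stay away from the
   cut-and-project set. When [n >= 2] such a hyperplane contains segments of every
   length. *)
Require Import Defs.
From mathcomp Require Import all_boot all_order all_algebra.
From mathcomp Require Import all_classical all_reals all_analysis.
From mathcomp Require Import ring lra.
Import Order.TTheory GRing.Theory Num.Theory.
Import numFieldNormedType.Exports.
Local Open Scope classical_set_scope.
Local Open Scope ring_scope.

(** * Bounds for the sup norm of matrices *)

Lemma mx_entry_le_norm (R : realType) (m n : nat) (A : 'M[R]_(m, n)) i j :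
  `|A i j| <= `|A|.
Proof.
rewrite [leRHS]/Num.norm /= mx_normrE; apply/bigmax_geP; right => /=.
by exists (i, j).
Qed.

Lemma mx_norm_le (R : realType) (m n : nat) (A : 'M[R]_(m, n)) (c : R) :
  0 <= c -> (forall i j, `|A i j| <= c) -> `|A| <= c.
Proof.
move=> c0 Ac; rewrite [leLHS]/Num.norm /= mx_normrE.
by apply/bigmax_leP; split => // -[i j] _; apply: Ac.
Qed.

Lemma mulmx_norm_le (R : realType) (m n p : nat)
    (A : 'M[R]_(m, n)) (B : 'M[R]_(n, p)) :
  `|A *m B| <= n%:R * `|A| * `|B|.
Proof.
apply: mx_norm_le => [|i j]; first by rewrite !mulr_ge0.
rewrite mxE; apply: le_trans (ler_norm_sum _ _ _) _.
apply: (@le_trans _ _ (\sum_(l < n) `|A| * `|B|)).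
  apply: ler_sum => l _; rewrite normrM.
  by apply: ler_pM => //; apply: mx_entry_le_norm.
by rewrite sumr_const card_ord -[leLHS]mulr_natl mulrA.
Qed.

(** * Comparison of an arbitrary norm with the sup norm *)

Section IsNorm.
Context {R : realType} {n : nat} {nrm : 'rV[R]_n -> R}.
Hypothesis hnrm : is_norm nrm.

Lemma is_normN x : nrm (- x) = nrm x.
Proof. by case: hnrm => _ hZ _; rewrite -scaleN1r hZ normrN1 mul1r. Qed.

Lemma is_norm0 : nrm 0 = 0.
Proof. by case: hnrm => _ hZ _; rewrite -(scale0r 0) hZ normr0 mul0r. Qed.

Lemma is_norm_ge0 x : 0 <= nrm x.
Proof.
case: hnrm => hD _ _; have := hD x (- x).
by rewrite subrr is_norm0 is_normN -mulr2n pmulrn_lge0.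
Qed.

Lemma is_norm_le_mx_norm : exists2 K, 0 <= K & forall x, nrm x <= K * `|x|.
Proof.
case: hnrm => hD hZ _.
exists (\sum_(i < n) nrm (delta_mx 0 i)).
  by apply: sumr_ge0 => i _; apply: is_norm_ge0.
move=> x; rewrite {1}(row_sum_delta x) mulr_suml.
elim/big_ind2: _ => [|a b c d ab cd|i _]; first by rewrite is_norm0.
  by apply: le_trans (hD _ _) _; apply: lerD.
by rewrite hZ mulrC ler_wpM2l ?is_norm_ge0 ?mx_entry_le_norm.
Qed.

Lemma is_norm_continuous : continuous nrm.
Proof.
have [K K0 hK] := is_norm_le_mx_norm.
case: hnrm => hD _ _.
have lip x y : `|nrm x - nrm y| <= K * `|x - y|.
  have h u v : nrm u - nrm v <= K * `|u - v|.
    rewrite lerBlDr; apply: le_trans (lerD (hK _) (lexx _)).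
    by have := hD (u - v) v; rewrite subrK.
  by rewrite ler_norml h andbT lerNl opprB distrC h.
move=> x; apply/(@cvgrPdist_le _ _ _ _ (nbhs_filter x)) => e e0.
apply/nbhs_ballP; exists (e / (K + 1)) => /=.
  by rewrite divr_gt0 ?ltr_wpDl.
move=> y; rewrite -ball_normE /= ltr_pdivlMr ?ltr_wpDl // => xy.
apply: le_trans (lip _ _) (le_trans _ (ltW xy)).
by rewrite mulrC ler_wpM2l // lerDl.
Qed.

(** By compactness [nrm] attains a minimum on the unit sphere of the sup norm; it is positive by
    definiteness, and homogeneity carries the bound to all vectors. *)
Lemma mx_norm_le_is_norm : exists2 K, 0 < K & forall x, `|x| <= K * nrm x.
Proof.
case: (hnrm) => _ hZ h0.
pose S : set 'rV[R]_n := [set x | `|x| = 1].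
have normalized (x : 'rV[R]_n) : x != 0 -> S (`|x|^-1 *: x).
  move=> x0; rewrite /S /= mx_normZ normfV normr_id mulVf //.
  by rewrite normr_eq0.
(* An empty sphere means that [0] is the only vector. *)
have [[x Sx]|S0] := pselect (S !=set0); last first.
  exists 1 => // x; have [->|/normalized Sx] := eqVneq x 0.
    by rewrite normr0 is_norm0 mulr0.
  by case: S0; exists (`|x|^-1 *: x).
have cS : compact S.
  apply: bounded_closed_compact.
    by exists 1; split => // M M1 y /= ->; exact: ltW.
  rewrite (_ : S = Num.norm @^-1` [set 1]) //.
  apply: preimage_closed; last exact: closed_eq.
  by move=> ? _; exact: norm_continuous.
have [|z /set_mem Sz zmin] := compact_EVT_min (ex_intro _ x Sx) cS (f := nrm).
  exact: continuous_subspaceT is_norm_continuous.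
have nz0 : 0 < nrm z.
  rewrite lt_neqAle is_norm_ge0 andbT eq_sym.
  apply/eqP => /h0 z0; move: Sz; rewrite /S /= z0 normr0 => /esym/eqP.
  by rewrite oner_eq0.
exists (nrm z)^-1; first by rewrite invr_gt0.
move=> y; have [->|y0] := eqVneq y 0; first by rewrite normr0 is_norm0 mulr0.
have := zmin _ (mem_set (normalized _ y0)).
rewrite hZ normfV normr_id ler_pdivlMl ?normr_gt0 // => h.
by rewrite ler_pdivlMl // mulrC.
Qed.

End IsNorm.

(** * Integer approximation and the dual lattice *)

(* Dirichlet's theorem by pigeonhole: the [Q ^ N] integer points of a cube of
   side [Q] are mapped by [C] into [(c * Q) ^ k] boxes of side [delta], and
   [Q ^ N] wins for large [Q] because [k < N]. *)
Lemma dirichlet_approximation (R : realType) (k N : nat) (C : 'M[R]_(k, N))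
    (delta : R) :
  (k < N)%N -> 0 < delta ->
  exists2 m : 'cV[int]_N, m != 0 & `|C *m map_mx intr m| <= delta.
Proof.
move=> kN d0.
pose M : R := N%:R * `|C|.
have M0 : 0 <= M by rewrite mulr_ge0.
pose c := (Num.truncn (2 * M / delta)).+1.
have hc : 2 * M / delta < c%:R by exact: truncnS_gt.
(* As [Q] exceeds [c ^ k], [(c * Q) ^ k < Q ^ k.+1 <= Q ^ N]. *)
pose Q := (c ^ k).+1.
pose m_ (f : {ffun 'I_N -> 'I_Q}) : 'cV[int]_N := \col_i (f i : nat)%:Z.
pose g (f : {ffun 'I_N -> 'I_Q}) j : R := (C *m map_mx intr (m_ f)) j 0.
have gM f j : `|g f j| <= Q%:R * M.
  rewrite /g; apply: le_trans (mx_entry_le_norm _ _ _ _ _ _) _.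
  apply: le_trans (mulmx_norm_le _ _ _ _ _ _) _.
  rewrite -/M mulrC ler_wpM2r //.
  apply: mx_norm_le => // i j'; rewrite !mxE /= normr_nat ler_nat.
  by rewrite ltnW.
pose box f j : nat := Num.truncn ((g f j + Q%:R * M) / delta).
have num0 f j : 0 <= (g f j + Q%:R * M) / delta.
  apply: divr_ge0; last exact: ltW.
  rewrite -lerBlDr sub0r.
  by have := gM f j; rewrite ler_norml => /andP[].
have box_lt f j : (box f j < c * Q)%N.
  rewrite truncn_lt_nat // natrM.
  apply: (@le_lt_trans _ _ (2 * M / delta * Q%:R)); last first.
    by rewrite ltr_pM2r.
  rewrite mulrAC ler_pM2r ?invr_gt0 //.
  have := gM f j; rewrite ler_norml => /andP[_].
  nra.
pose F f : {ffun 'I_k -> 'I_(c * Q)} := [ffun j => Ordinal (box_lt f j)].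
have Fninj : ~ injective F.
  move=> /leq_card; rewrite !card_ffun !card_ord leqNgt => /negP; apply.
  rewrite expnMn; apply: (@leq_trans (Q ^ k.+1)).
    by rewrite expnS ltn_pmul2r // expn_gt0.
  by rewrite leq_pexp2l.
have [f [f' [ff' neq]]] : exists f f', F f = F f' /\ f <> f'.
  apply: contrapT => h; apply: Fninj => f f' e.
  by apply: contrapT => ne; apply: h; exists f, f'.
exists (m_ f - m_ f').
  rewrite subr_eq0; apply/eqP => e; apply: neq; apply/ffunP => i.
  apply: val_inj; move/colP/(_ i): e; rewrite !mxE => -[] //.
apply: mx_norm_le => [|j j']; first exact: ltW.
rewrite ord1 map_mxB mulmxBr !mxE.
have -> : \sum_j0 C j j0 * (map_mx intr (m_ f)) j0 0 = g f j by rewrite /g mxE.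
have -> : \sum_j0 C j j0 * (map_mx intr (m_ f')) j0 0 = g f' j
  by rewrite /g mxE.
have eb : box f j = box f' j.
  by move/ffunP/(_ j): ff'; rewrite !ffunE => -[].
(* Two values in the same box differ by less than [delta]. *)
have /andP[] := truncn_itv (num0 f j); have /andP[] := truncn_itv (num0 f' j).
rewrite -/(box f j) -/(box f' j) -eb !ler_pdivlMr // !ltr_pdivrMr // -natr1.
rewrite mulrDl mul1r => h1 h2 h3 h4.
rewrite ler_norml; lra.
Qed.

(* [x |-> x *m v] is a functional taking integer values on the lattice spanned
   by the rows of [B]; if [v] were fixed by [P], the integer vector [B *m v]
   would have entries smaller than [1] and hence vanish. *)
Lemma small_dual_vector (R : realType) (N : nat) (B P : 'M[R]_N) (M : R) :
  B \in unitmx -> (\rank P < N)%N ->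
  exists v : 'cV[R]_N,
    [/\ exists m : 'cV[int]_N, B *m v = map_mx intr m,
        P *m v <> v
      & forall w : 'rV[R]_N, `|w| <= M -> `|w *m (P *m v)| <= 4^-1].
Proof.
move=> uB rP.
pose r := \rank P; pose D := col_base P.
(* [K] dominates the factors multiplying [|u|] in the bounds for [w *m D *m u] and [B *m D *m u];
   the summand [1] makes it positive. *)
pose K : R := r%:R * (N%:R * `|M| * `|D|) + r%:R * `|B *m D| + 1.
have K1 : 0 <= r%:R * (N%:R * `|M| * `|D|) /\ 0 <= r%:R * `|B *m D|.
  by split; rewrite !mulr_ge0.
have K0 : 0 < K by rewrite /K; lra.
have d0 : 0 < (4 * K)^-1 by rewrite invr_gt0 mulr_gt0.
have dK a : a <= K -> a * (4 * K)^-1 <= 4^-1.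
  by move=> aK; rewrite invfM mulrCA ler_piMr // ler_pdivrMr // mul1r.
(* [P *m v = D *m u], where [u = row_base P *m v] has only [r < N] entries, so it can be made
   small. *)
have [m m0 um] := dirichlet_approximation _ _ _ (row_base P *m invmx B) _ rP d0.
set u := _ *m map_mx _ m in um.
pose v := invmx B *m map_mx intr m : 'cV[R]_N.
have Pv : P *m v = D *m u.
  by rewrite -{1}(mulmx_base P) -mulmxA /u /v [row_base P *m (_ *m _)]mulmxA.
have Bv : B *m v = map_mx intr m by rewrite mulmxA mulmxV // mul1mx.
exists v; split; first by exists m.
- move=> Pvv; move/eqP: m0; apply; apply/colP => i.
  have : `|B *m v| < 1.
    rewrite -Pvv Pv mulmxA; apply: le_lt_trans (mulmx_norm_le _ _ _ _ _ _) _.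
    apply: (@le_lt_trans _ _ 4^-1); last by lra.
    apply: le_trans (ler_wpM2l _ um) _; first by rewrite mulr_ge0.
    by apply: dK; rewrite /K; lra.
  move=> /(le_lt_trans (mx_entry_le_norm _ _ _ _ i 0)).
  by rewrite Bv !mxE -intr_norm ltrz1; case: (m i 0) => [[|a]|a].
- move=> w wM; rewrite Pv mulmxA.
  apply: le_trans (mulmx_norm_le _ _ _ _ _ _) _.
  apply: le_trans (ler_wpM2l _ um) _; first by rewrite mulr_ge0.
  apply: dK; apply: (@le_trans _ _ (r%:R * (N%:R * `|M| * `|D|))).
    rewrite ler_wpM2l //; apply: le_trans (mulmx_norm_le _ _ _ _ _ _) _.
    rewrite ler_wpM2r // ler_wpM2l //; apply: le_trans wM _.
    exact: ler_norm.
  by rewrite /K; lra.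
Qed.

(** * A slab free of points of the cut-and-project set *)

Lemma intr_dist_half (R : realType) (j : int) (s : R) :
  `|s| <= 4^-1 -> 4^-1 <= `|j%:~R - s - 2^-1|.
Proof.
rewrite ler_norml => /andP[h1 h2].
have [j0|j0] := lerP j 0.
  have : j%:~R <= 0 :> R by rewrite lerz0.
  by move=> h; rewrite ler0_norm; lra.
have : 1 <= j%:~R :> R by rewrite ler1z -gtz0_ge1.
by move=> h; rewrite ger0_norm; lra.
Qed.

(** [G] is the dual vector [v] restricted to [Vphys] and read in [R^n] through the inverse of
    [phi]. *)
Lemma cut_and_project_avoids_slab (R : realType) (n : nat)
    (Y : set 'rV[R]_n) :
  (1 <= n)%N -> is_cut_and_project_set Y ->
  exists (G : 'cV[R]_n) (c : R),
    G != 0 /\ forall y, Y y -> 4^-1 <= `|(y *m G) 0 0 - c|.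
Proof.
move=> n0 [k [Vp [Vi [phi [L [W]]]]]].
move=> [_ [[dV fV dp _] [bphi [tL [[_ bW] ->]]]]].
have cap : (Vp :&: Vi)%VS = 0%VS by apply/directv_addP.
have piD x : daddv_pi Vp Vi x + daddv_pi Vi Vp x = x.
  by apply: daddv_pi_add => //; rewrite fV memvf.
pose P := lin1_mx (daddv_pi Vi Vp).
have PE x : x *m P = daddv_pi Vi Vp x by rewrite mul_rV_lin1.
(* [P] kills [Vphys], which is nonzero because [n >= 1]. *)
have rP : (\rank P < n + k)%N.
  rewrite ltn_neqAle rank_leq_row andbT; apply/negP => fP.
  have xV : vpick Vp \in Vp := memv_pick Vp.
  have : vpick Vp *m P = 0.
    rewrite PE; apply: (addrI (vpick Vp)).
    by rewrite addr0 -{1}(daddv_pi_id cap xV) piD.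
  rewrite -(mul0mx _ P) => /(row_free_inj fP)/eqP; rewrite vpick0 => /eqP Vp0.
  by move: n0; rewrite -dp Vp0 dimv0.
case: tL => x0 [Lam [[B [uB ->]] ->]].
have [M WM] : exists M, forall w, W w -> `|w| <= M.
  case: bW => M [_ hM]; exists (M + 1) => w Ww.
  by apply: hM => //; rewrite ltrDl.
have [v [[m Bv] Pv vW]] := small_dual_vector _ _ _ _ M uB rP.
pose f := linfun phi.
have kf : lker f == 0%VS.
  by apply/lker0P => a b; rewrite !lfunE /=; exact: (bij_inj bphi).
pose g := mulmxr v \o (vsval \o f^-1%VF).
have gphi a : g (phi a) = vsval a *m v.
  by rewrite /g /= -[phi a](lfunE phi) lker0_lfunK.
have gE y : y *m lin1_mx g = g y by exact: mul_rV_lin1.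
exists (lin1_mx g), ((x0 *m v) 0 0 + 2^-1); split.
  (* If [G = 0], then [v] vanishes on [Vphys], so it only sees internal components and
     [P *m v = v]. *)
  apply/eqP => g0; apply: Pv; apply/row_matrixP => i.
  have piv x : daddv_pi Vp Vi x *m v = 0.
    rewrite -(vsprojK (memv_pi Vp Vi x)) -gphi -gE g0.
    by rewrite mulmx0.
  have := piv (delta_mx 0 i); rewrite !rowE mulmxA PE => h.
  by rewrite -[in RHS](piD (delta_mx 0 i)) mulmxDl h add0r.
move=> _ [_ [_ [[_ [z _ <-] <-] /= Wx] <-] <-].
rewrite gE gphi vsprojK ?memv_pi //.
set x := x0 + _ in Wx *.
have -> : daddv_pi Vp Vi x *m v = x *m v - x *m (P *m v).
  by rewrite mulmxA PE -[X in X *m v - _](piD x) mulmxDl addrK.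
have -> : x *m v = x0 *m v + map_mx intr (z *m m).
  by rewrite mulmxDl -mulmxA Bv map_mxM.
(* [P] is idempotent; this brings in the internal component [x *m P], which lies in [W]. *)
have -> : x *m (P *m v) = (x *m P) *m (P *m v).
  by rewrite !mulmxA !PE daddv_pi_proj // capvC.
have hs : `|(x *m P *m (P *m v)) 0 0| <= 4^-1.
  apply: le_trans (mx_entry_le_norm _ _ _ _ _ _) _.
  by apply: vW; apply: WM; rewrite PE.
have := intr_dist_half _ ((z *m m) 0 0) _ hs.
set s := (x *m P *m (P *m v)); set q := z *m m; set p := x0 *m v.
rewrite !mxE; congr (_ <= `|_|); ring.
Qed.

(** * The hyperplane and the conclusion *)

Lemma dim_lker_mulmxr (R : realType) (n : nat) (G : 'cV[R]_n) :
  G != 0 -> \dim (lker (linfun (mulmxr G : 'rV[R]_n -> 'rV[R]_1))) = n.-1.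
Proof.
move=> G0; set f := linfun _.
have := limg_ker_dim f fullv; rewrite capfv dimvf /dim /= mul1n.
suff -> : \dim (limg f) = 1%N by rewrite addn1 => /(congr1 predn).
apply/eqP; rewrite eqn_leq; apply/andP; split.
  by apply: leq_trans (dimvS (subvf _)) _; rewrite dimvf /dim /= muln1.
rewrite lt0n dimv_eq0; apply: contra G0 => /eqP f0.
apply/eqP/row_matrixP => i; rewrite row0 rowE.
have := memv_img f (memvf (delta_mx 0 i : 'rV[R]_n)).
by rewrite f0 memv0 lfunE /= => /eqP.
Qed.

Theorem theorem1p1 (R : realType) (n : nat) (hn : (1 <= n)%N)
    (nrm : 'rV[R]_n -> R) (hnrm : is_norm nrm)
    (Y : set 'rV[R]_n) (hY : is_cut_and_project_set Y) :
  ((2 <= n)%N -> ~ dense_forest nrm Y) /\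
  exists (eps : R) (Z : set 'rV[R]_n),
    [/\ 0 < eps, affine_subspace n.-1 Z
      & Y `&` neighborhood nrm Z eps = set0].
Proof.
suff [eps [Z [e0 aZ YZ]]] : exists (eps : R) (Z : set 'rV[R]_n),
    [/\ 0 < eps, affine_subspace n.-1 Z & Y `&` neighborhood nrm Z eps = set0].
  split; last by exists eps, Z.
  (* For [n >= 2] the direction [U] of [Z] is nonzero, so [Z] contains a segment of length [v eps],
     all of whose points are at least [eps] away from [Y]. *)
  move=> n2 [v /(_ _ e0)[v0 hv]]; case: aZ YZ => p [U [dU ->]] YZ.
  have u0 : vpick U != 0.
    by rewrite vpick0 -dimv_eq0 dU -lt0n -ltnS prednK // ltnW.
  have nu : nrm (vpick U) != 0.
    by case: hnrm => _ _ h0; apply: contra u0 => /eqP/h0/eqP.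
  pose u := (v eps / nrm (vpick U)) *: vpick U.
  have uU : u \in U by rewrite memvZ ?memv_pick.
  case: (hv p (p + u)).
    case: (hnrm) => _ hZ _; rewrite addrC addKr hZ normf_div.
    by rewrite !ger0_norm ?is_norm_ge0 ?divfK // ltW.
  move=> _ [t _ <-] [y Yy xy].
  have : (Y `&` neighborhood nrm [set p + u | u in [set u | u \in U]] eps) y.
    split => //; exists (p + t *: (p + u - p)); last first.
      by rewrite -(is_normN hnrm) opprB.
    by exists (t *: u); [exact: memvZ | rewrite [p + u]addrC addrK].
  by rewrite YZ.
have [G [c [G0 hG]]] := cut_and_project_avoids_slab _ _ _ hn hY.
have [K K0 hK] := mx_norm_le_is_norm hnrm.
pose g := linfun (mulmxr G : 'rV[R]_n -> 'rV[R]_1).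
have [i Gi] : exists i, G i 0 != 0.
  apply/existsP; apply: contraNT G0 => /existsPn h; apply/eqP/colP => i.
  by rewrite mxE; apply/eqP; have := h i; rewrite negbK.
(* A point where the functional [G] takes the value [c]. *)
pose p : 'rV[R]_n := (c / G i 0) *: delta_mx 0 i.
have pG : (p *m G) 0 0 = c by rewrite -scalemxAl -rowE !mxE divfK.
(* [A] is a Lipschitz constant of [G] for [nrm], made positive by the [1]; within [(4 * A)^-1] of
   the hyperplane, [G] is less than [1/4] away from [c]. *)
pose A : R := n%:R * K * `|G| + 1.
have A0 : 0 < A by rewrite ltr_wpDl // !mulr_ge0 // ltW.
exists (4 * A)^-1, [set p + u | u in [set u | u \in lker g]]; split.
- by rewrite invr_gt0 mulr_gt0.
- by exists p, (lker g); split => //; exact: dim_lker_mulmxr.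
apply/seteqP; split => // y [Yy [_ [u + <-] yz]].
rewrite /= memv_ker lfunE /= => /eqP uG.
have := hG _ Yy; rewrite leNgt => /negP; apply.
set d := y - (p + u) in yz.
have -> : (y *m G) 0 0 - c = (d *m G) 0 0.
  rewrite -{1}(subrK (p + u) y) -/d !mulmxDl uG addr0 !mxE.
  by move: pG; rewrite !mxE => ->; rewrite addrK.
apply: le_lt_trans (mx_entry_le_norm _ _ _ _ _ _) _.
apply: le_lt_trans (mulmx_norm_le _ _ _ _ _ _) _.
have nd : 0 <= nrm d := is_norm_ge0 hnrm d.
apply: (@le_lt_trans _ _ (A * nrm d)).
  apply: (@le_trans _ _ (n%:R * (K * nrm d) * `|G|)).
    by rewrite ler_wpM2r // ler_wpM2l.
  by rewrite /A; lra.
by rewrite -ltr_pdivlMl // mulrC -invfM.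
Qed.
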